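(* Let $R$ be an associative and unital ring with a ring endomorphism $\alpha$ and pairwise commuting derivations $\delta_1,\ldots,\delta_n$. If $\alpha$ commutes with $\delta_1,\ldots,\delta_n$ and is extended homogeneously to a ring endomorphism $\widehat\alpha$ on $R[x_1,\ldots,x_n;\delta_1,\ldots,\delta_n]$, then $$R[x_1,\ldots,x_n;\delta_1,\ldots,\delta_n]^{\widehat\alpha}=R^\alpha[x_1,\ldots,x_n;\delta_1,\ldots,\delta_n].$$
   Context: Ring endomorphisms of unital rings respect the identity element. For pairwise commuting derivations $\delta_1,\ldots,\delta_n$ on an associative unital ring $R$, the iterated differential polynomial ring $R[x_1,\ldots,x_n;\delta_1,\ldots,\delta_n]$ is the free left $R$-module with basis the monomials $x_1^{i_1}\cdots x_n^{i_n}$, $i_1,\ldots,i_n\in\mathbb{N}$, with (associative, unital) multiplication the bi-additive extension of $$\big(rx_1^{i_1}\cdots x_n^{i_n}\big)\big(sx_1^{j_1}\cdots x_n^{j_n}\big)=\sum_{\ell_1=0}^{i_1}\cdots\sum_{\ell_n=0}^{i_n}\binom{i_1}{\ell_1}\cdots\binom{i_n}{\ell_n}\, r\cdot\big(\delta_1^{i_1-\ell_1}\circ\cdots\circ\delta_n^{i_n-\ell_n}\big)(s)\,x_1^{j_1+\ell_1}\cdots x_n^{j_n+\ell_n}$$ for $r,s\in R$. The homogeneous extension $\widehat\alpha$ of $\alpha$ is given by $\widehat\alpha(rx_1^{i_1}\cdots x_n^{i_n})=\alpha(r)x_1^{i_1}\cdots x_n^{i_n}$, extended additively. For an associative ring $A$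 with ring endomorphism $\beta$, $A^\beta$ denotes the hom-associative ring with the same additive group, multiplication $a*b:=\beta(ab)$ and twisting map $\beta$. $R^\alpha[x_1,\ldots,x_n;\delta_1,\ldots,\delta_n]$ denotes the nonassociative ring of formal sums $\sum r_{i_1,\ldots,i_n}x_1^{i_1}\cdots x_n^{i_n}$ (finitely many nonzero coefficients in $R$) with pointwise addition and multiplication given by the same displayed formula, but with the product $r\cdot(\cdots)$ of coefficients taken in $R^\alpha$, i.e. with $r*s=\alpha(rs)$. Equality of the two sides means that they are equal as nonassociative rings (same additive group and same multiplication). *)

(* Defs.v *)
From HB Require Import structures.
From mathcomp Require Import all_boot all_order all_algebra finmap.
From mathcomp.multinomials Require Import mpoly monalg.

Set Implicit Arguments.
Unset Strict Implicit.
Unset Printing Implicit Defensive.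

Import GRing.Theory.
Local Open Scope ring_scope.

(* mpoly and monalg both define this notation, differently. *)
Local Notation "g @_ k" := (monalg.mcoeff k g) : ring_scope.

Record nonassocRing := NonassocRing {
  na_sort :> zmodType;
  na_mul : na_sort -> na_sort -> na_sort;
  na_mulDl : left_distributive na_mul +%R;
  na_mulDr : right_distributive na_mul +%R
}.

(* The twisting map is required to be additive only, not multiplicative. *)
Record homAssocRing := HomAssocRing {
  ha_ring :> nonassocRing;
  ha_twist : {additive ha_ring -> ha_ring};
  ha_mulA : forall a b c : ha_ring,
    na_mul (ha_twist a) (na_mul b c) = na_mul (na_mul a b) (ha_twist c)
}.

Definition nonassoc_of (A : pzRingType) : nonassocRing :=
  @NonassocRing A *%R (@mulrDl A) (@mulrDr A).

Section Yau.
Variables (A : pzRingType) (beta : {rmorphism A -> A}).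

Definition yau_mul (a b : A) : A := beta (a * b).

Fact yau_mulDl : left_distributive yau_mul +%R.
Proof. by move=> a b c; rewrite /yau_mul mulrDl rmorphD. Qed.

Fact yau_mulDr : right_distributive yau_mul +%R.
Proof. by move=> a b c; rewrite /yau_mul mulrDr rmorphD. Qed.

Fact yau_mulA (a b c : A) :
  yau_mul (beta a) (yau_mul b c) = yau_mul (yau_mul a b) (beta c).
Proof. by rewrite /yau_mul -!rmorphM mulrA. Qed.

(* The hom-associative ring written A^beta. *)
Definition yau_twist : homAssocRing :=
  @HomAssocRing (NonassocRing yau_mulDl yau_mulDr) beta yau_mulA.

End Yau.

Section SupportSum.
Variables (K : choiceType) (G V : zmodType) (h : K -> G -> V).
Hypothesis hD : forall k, {morph h k : x y / x + y}.

Lemma h0 k : h k 0 = 0.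
Proof. by apply: (@addrI _ (h k 0)); rewrite -hD !addr0. Qed.

Lemma msum_sub (f : {malg G[K]}) (D : {fset K}) : (msupp f `<=` D)%fset ->
  \sum_(k <- msupp f) h k f@_k = \sum_(k <- D) h k f@_k.
Proof.
move=> sfD; rewrite (big_fset_incl _ sfD) //= => k _ /mcoeff_outdom ->.
exact: h0.
Qed.

Lemma msumD (f g : {malg G[K]}) :
  \sum_(k <- msupp (f + g)) h k (f + g)@_k
  = \sum_(k <- msupp f) h k f@_k + \sum_(k <- msupp g) h k g@_k.
Proof.
rewrite (msum_sub (msuppD_le f g)).
rewrite (@msum_sub f (msupp f `|` msupp g)%fset) ?fsubsetUl //.
rewrite (@msum_sub g (msupp f `|` msupp g)%fset) ?fsubsetUr //.
by rewrite -big_split; apply: eq_bigr => k _; rewrite mcoeffD hD.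
Qed.

Lemma msumU k r : \sum_(i <- msupp << r *g k >>) h i << r *g k >>@_i = h k r.
Proof.
by rewrite (msum_sub msuppU_le) big_seq_fset1 mcoeffUU.
Qed.

End SupportSum.

Lemma malg_ind (K : choiceType) (G : zmodType) (P : {malg G[K]} -> Prop) :
  (forall k r, P << r *g k >>) -> P 0 -> (forall f g, P f -> P g -> P (f + g)) ->
  forall f, P f.
Proof.
by move=> PU P0 PD f; rewrite (monalgE f); elim/big_rec: _ => // k g _; apply: PD.
Qed.

Lemma malg_ext (K : choiceType) (G V : zmodType) (F1 F2 : {malg G[K]} -> V) :
  {morph F1 : f g / f + g} -> {morph F2 : f g / f + g} ->
  (forall k r, F1 << r *g k >> = F2 << r *g k >>) -> F1 =1 F2.
Proof.
move=> F1D F2D FU.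
have zero (F : {malg G[K]} -> V) : {morph F : f g / f + g} -> F 0 = 0.
  by move=> FD; apply: (@addrI _ (F 0)); rewrite -FD !addr0.
by elim/malg_ind => [||f g IHf IHg]; rewrite ?FU ?zero // F1D F2D IHf IHg.
Qed.

Section NonassocPoly.
Variables (S : nonassocRing) (n : nat) (delta : 'I_n -> {additive S -> S}).

(* delta_1^(e_1) o ... o delta_n^(e_n) *)
Definition delta_pow (e : 'I_n -> nat) : S -> S :=
  \big[(fun f g => f \o g)/id]_(k < n) iter (e k) (delta k).

(* (r x^i)(s x^j); the index l runs over the box of all (l_1, ..., l_n) with
   0 <= l_k <= i_k. *)
Definition monom_mul (r : S) (i : multinom n) (s : S) (j : multinom n) :
    {malg S[multinom n]} :=
  \sum_(l : {dffun forall k : 'I_n, 'I_(i k).+1})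
     << na_mul r (delta_pow (fun k => i k - l k)%N s)
          *+ (\prod_(k < n) 'C(i k, l k))%N
        *g [multinom (j k + l k)%N | k < n] >>.

Definition poly_mul (f g : {malg S[multinom n]}) : {malg S[multinom n]} :=
  \sum_(i <- msupp f) \sum_(j <- msupp g) monom_mul f@_i i g@_j j.

Lemma delta_powD e : {morph delta_pow e : x y / x + y}.
Proof.
rewrite /delta_pow; elim/big_rec: _ => // k f _ IH x y /=; rewrite IH.
by elim: (e k) => //= m ->; rewrite raddfD.
Qed.

Lemma eq_delta_pow e e' : e =1 e' -> delta_pow e =1 delta_pow e'.
Proof. by move=> ee s; rewrite /delta_pow; under eq_bigr do rewrite ee. Qed.

Lemma na_mul0r (a : S) : na_mul 0 a = 0.
Proof. by apply: (@addrI _ (na_mul 0 a)); rewrite -na_mulDl !addr0. Qed.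

Lemma na_mulr0 (a : S) : na_mul a 0 = 0.
Proof. by apply: (@addrI _ (na_mul a 0)); rewrite -na_mulDr !addr0. Qed.

Lemma monom_mulDl i s j : {morph (fun r => monom_mul r i s j) : x y / x + y}.
Proof.
move=> x y; rewrite /monom_mul -big_split; apply: eq_bigr => l _ /=.
by rewrite na_mulDl mulrnDl monalgUD.
Qed.

Lemma monom_mulDr r i j : {morph (fun s => monom_mul r i s j) : x y / x + y}.
Proof.
move=> x y; rewrite /monom_mul -big_split; apply: eq_bigr => l _ /=.
by rewrite delta_powD na_mulDr mulrnDl monalgUD.
Qed.

Fact poly_mulDl : left_distributive poly_mul +%R.
Proof.
move=> f g p; rewrite /poly_mul.
apply: (msumD (h := fun i r => \sum_(j <- msupp p) monom_mul r i p@_j j)).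
move=> i x y; rewrite -big_split; apply: eq_bigr => j _; exact: monom_mulDl.
Qed.

Fact poly_mulDr : right_distributive poly_mul +%R.
Proof.
move=> p f g; rewrite /poly_mul -big_split; apply: eq_bigr => i _ /=.
apply: (msumD (h := fun j s => monom_mul p@_i i s j)) => j; exact: monom_mulDr.
Qed.

Lemma poly_mulUU r i s j :
  poly_mul << r *g i >> << s *g j >> = monom_mul r i s j.
Proof.
rewrite /poly_mul (msumU (h := fun i r =>
  \sum_(j' <- msupp << s *g j >>) monom_mul r i << s *g j >>@_j' j')).
  apply: (msumU (h := fun j s => monom_mul r i s j)) => k; exact: monom_mulDr.
move=> k x y; rewrite -big_split; apply: eq_bigr => j' _; exact: monom_mulDl.
Qed.

(* S[x_1, ..., x_n; delta_1, ..., delta_n] for a nonassociative ring S of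
   coefficients. *)
Definition nonassoc_poly : nonassocRing := NonassocRing poly_mulDl poly_mulDr.

Lemma mcoeff_monom_mul r i s j m :
  (monom_mul r i s j)@_m =
  if (j <= m)%MM then
    na_mul r (delta_pow (fun k => i k - (m k - j k))%N s)
      *+ (\prod_(k < n) 'C(i k, m k - j k))%N
  else 0.
Proof.
rewrite /monom_mul raddf_sum /=; under eq_bigr do rewrite mcoeffU.
case: (boolP (j <= m)%MM) => [/mnm_lepP lejm | nle].
  case: (boolP [forall k, m k - j k <= i k]%N) => [/forallP lei | /forallPn[k0]].
    have lt k : (m k - j k < (i k).+1)%N by rewrite ltnS.
    pose l0 : {dffun forall k : 'I_n, 'I_(i k).+1} := [ffun k => Ordinal (lt k)].
    have l0E k : l0 k = (m k - j k)%N :> nat by rewrite ffunE.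
    rewrite (bigD1 l0) //= [X in _ + X]big1 ?addr0 => [|l ne].
      have -> : [multinom (j k + l0 k)%N | k < n] = m.
        by apply/mnmP => k; rewrite mnmE l0E subnKC.
      rewrite eqxx mulr1n; congr (na_mul _ _ *+ _).
        by apply: eq_delta_pow => k; rewrite l0E.
      by apply: eq_bigr => k _; rewrite l0E.
    case: eqP => [/mnmP e|]; rewrite ?mulr0n //; case/negP: ne; apply/eqP/ffunP => k.
    by apply/val_inj; rewrite /= l0E -(e k) mnmE addKn.
  rewrite -ltnNge => lt0; rewrite (bigD1 k0) //= bin_small // mul0n mulr0n.
  rewrite [LHS]big1 // => l _; case: eqP => [/mnmP/(_ k0)|]; rewrite ?mulr0n //.
  rewrite mnmE => e; move: lt0; rewrite -e addKn ltnNge -ltnS.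
  by rewrite ltn_ord.
rewrite [LHS]big1 // => l _; case: eqP => [/mnmP e|]; rewrite ?mulr0n //.
by case/mnm_lepP: nle => k; rewrite -(e k) mnmE leq_addr.
Qed.

End NonassocPoly.

Section MonomialOperators.
Variables (R : pzRingType) (K : choiceType) (d : {additive R -> R}) (sh : K -> K).

Local Notation M := {malg R[K]}.
Local Notation "<< r *g i >>" := (@mkmalgU K R i r) : ring_scope.

Definition shift_term (i : K) (r : R) : M := << r *g sh i >> + << d r *g i >>.

(* When sh is multiplication by x, these are left multiplication by x and by a
   constant in the differential polynomial ring. *)
Definition lmulX (f : M) : M := \sum_(i <- msupp f) shift_term i f@_i.
Definition lmulC (r : R) (f : M) : M :=
  \sum_(i <- msupp f) << r * f@_i *g i >>.

Fact shift_termD i : {morph shift_term i : x y / x + y}.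
Proof.
move=> x y; rewrite /shift_term (raddfD d) !monalgUD; exact: addrACA.
Qed.

Lemma lmulXD : {morph lmulX : f g / f + g}.
Proof. move=> f g; exact: (msumD shift_termD). Qed.
Lemma lmulX0 : lmulX 0 = 0.
Proof. by rewrite /lmulX msupp0 big_seq_fset0. Qed.
Lemma lmulXU i r : lmulX << r *g i >> = << r *g sh i >> + << d r *g i >>.
Proof. exact: (msumU shift_termD). Qed.

Fact const_termD (r : R) (i : K) :
  {morph (fun s => << r * s *g i >>) : x y / x + y}.
Proof. by move=> x y; rewrite mulrDr monalgUD. Qed.

Lemma lmulCD r : {morph lmulC r : f g / f + g}.
Proof. move=> f g; exact: (msumD (const_termD r)). Qed.
Lemma lmulC0 r : lmulC r 0 = 0.
Proof. by rewrite /lmulC msupp0 big_seq_fset0. Qed.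
Lemma lmulCU r i s : lmulC r << s *g i >> = << r * s *g i >>.
Proof. exact: (msumU (const_termD r)). Qed.

Lemma mcoeff_lmulC r f m : (lmulC r f)@_m = r * f@_m.
Proof.
elim/malg_ind: f => [i s||f g IHf IHg].
- by rewrite lmulCU !mcoeffU mulrnAr.
- by rewrite lmulC0 !mcoeff0 mulr0.
- by rewrite lmulCD !mcoeffD IHf IHg mulrDr.
Qed.

Lemma lmulCA r s f : lmulC r (lmulC s f) = lmulC (r * s) f.
Proof. by apply/malgP => m; rewrite !mcoeff_lmulC mulrA. Qed.

Lemma mcoeff_lmulX f m :
  injective sh -> (lmulX f)@_(sh m) = f@_m + d f@_(sh m).
Proof.
move=> inj; elim/malg_ind: f => [i s||f g IHf IHg].
- by rewrite lmulXU mcoeffD !mcoeffU (inj_eq inj) raddfMn.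
- by rewrite lmulX0 !mcoeff0 raddf0 addr0.
- by rewrite lmulXD !mcoeffD IHf IHg raddfD addrACA.
Qed.

Lemma mcoeff_lmulX_out f m : (forall i, sh i != m) -> (lmulX f)@_m = d f@_m.
Proof.
move=> out; elim/malg_ind: f => [i s||f g IHf IHg].
- by rewrite lmulXU mcoeffD !mcoeffU (negbTE (out i)) mulr0n add0r raddfMn.
- by rewrite lmulX0 !mcoeff0 raddf0.
- by rewrite lmulXD !mcoeffD IHf IHg raddfD.
Qed.

Lemma lmulX_lmulC r f :
  (forall a b, d (a * b) = d a * b + a * d b) ->
  lmulX (lmulC r f) = lmulC r (lmulX f) + lmulC (d r) f.
Proof.
move=> leib; elim/malg_ind: f => [i s||f g IHf IHg].
- rewrite !(lmulCU, lmulXU, lmulCD) leib monalgUD.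
  by rewrite -addrA [X in _ + X]addrC.
- by rewrite !(lmulC0, lmulX0) addr0.
- by rewrite !(lmulCD, lmulXD) IHf IHg addrACA.
Qed.

End MonomialOperators.

Record commDerivations (R : pzRingType) (n : nat) := CommDerivations {
  derivs :> 'I_n -> {additive R -> R};
  deriv_leibniz : forall k a b,
    derivs k (a * b) = derivs k a * b + a * derivs k b;
  deriv_comm : forall k l a, derivs k (derivs l a) = derivs l (derivs k a)
}.

Section DiffPoly.
Variables (R : pzRingType) (n : nat) (delta : commDerivations R n).

Let T : nonassocRing := @nonassoc_poly (nonassoc_of R) n delta.
Let dpow := @delta_pow (nonassoc_of R) n delta.

Local Notation M := {malg R[multinom n]}.
Local Notation "<< r *g i >>" := (@mkmalgU (multinom n) R i r) : ring_scope.

Definition diff_mul (f g : M) : M :=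
  @poly_mul (nonassoc_of R) n delta f g.
Definition diff_one : M := << 1 *g 0%MM >>.

Local Notation "f ** g" := (diff_mul f g) (at level 40).

Lemma diff_mulDl : left_distributive diff_mul +%R.
Proof. exact: (@poly_mulDl (nonassoc_of R) n delta). Qed.
Lemma diff_mulDr : right_distributive diff_mul +%R.
Proof. exact: (@poly_mulDr (nonassoc_of R) n delta). Qed.
Lemma diff_mul0r f : 0 ** f = 0.
Proof. exact: (@na_mul0r T). Qed.
Lemma diff_mulr0 f : f ** 0 = 0.
Proof. exact: (@na_mulr0 T). Qed.

Lemma deriv1 k : delta k 1 = 0.
Proof.
have := deriv_leibniz delta k 1 1; rewrite !mulr1 mul1r => e.
by apply: (@addrI _ (delta k 1)); rewrite addr0 -e.
Qed.

Lemma iter_deriv_comm k l m a :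
  delta k (iter m (delta l) a) = iter m (delta l) (delta k a).
Proof. by elim: m => //= m <-; rewrite deriv_comm. Qed.

Lemma dpowS e k a :
  dpow (fun l => e l + (k == l))%N a = delta k (dpow e a).
Proof.
rewrite /dpow /delta_pow; move: (index_enum_uniq 'I_n) (mem_index_enum k).
elim: (index_enum _) => //= l r IH /andP[lr ur]; rewrite inE !big_cons /=.
case: eqVneq => [kl _|_ /= kr].
  subst l; rewrite addn1 /=; congr (delta k (iter _ _ _)).
  congr (_ a); rewrite !big_seq; apply: eq_bigr => i ir.
  by case: eqVneq => [e0|]; rewrite ?addn0 //; rewrite e0 ir in lr.
by rewrite addn0 IH // iter_deriv_comm.
Qed.

Local Notation shift k := (fun i : multinom n => i + U_(k))%MM.
Local Notation lmulX k := (@lmulX R (multinom n) (delta k) (shift k)).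
Local Notation lmulC := (@lmulC R (multinom n)).

Let mono (r : R) (i : multinom n) (s : R) (j : multinom n) : M :=
  @monom_mul (nonassoc_of R) n delta r i s j.

Lemma mcoeff_mono r i s j m :
  (mono r i s j)@_m =
  if (j <= m)%MM then
    r * dpow (fun k => i k - (m k - j k))%N s
      *+ (\prod_(k < n) 'C(i k, m k - j k))%N
  else 0.
Proof. exact: (@mcoeff_monom_mul (nonassoc_of R) n delta). Qed.

Lemma diff_mulUU r i s j : (<< r *g i >> : M) ** << s *g j >>
  = mono r i s j.
Proof. exact: (@poly_mulUU (nonassoc_of R) n delta). Qed.

Lemma mono_lmulC r i s j :
  mono r i s j
  = lmulC r (mono 1 i s j).
Proof.
apply/malgP => m; rewrite [RHS]mcoeff_lmulC [LHS]mcoeff_mono.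
rewrite [in RHS]mcoeff_mono; case: ifP => _; last by rewrite mulr0.
by rewrite /= mulrnAr mul1r.
Qed.

Lemma mono_lmulX k i s j :
  mono 1 (i + U_(k))%MM s j
  = lmulX k (mono 1 i s j).
Proof.
have EU (l : 'I_n) : U_(k)%MM l = (k == l) by rewrite mnm1E.
have inj : injective (shift k).
  move=> u v /mnmP uv; apply/mnmP => l; have := uv l.
  by rewrite !mnmDE => /eqP; rewrite eqn_add2r => /eqP.
(* coefficient of the right-hand side, up to the term coming from the shift *)
have main m : (j <= m)%MM ->
    (mono 1 (i + U_(k))%MM s j)@_m
    = (if (0 < m k - j k)%N then
         (mono 1 i s j)@_(m - U_(k))%MM else 0)
      + delta k (mono 1 i s j)@_m.
  move=> lejm; have lem l := mnm_lepP lejm l.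
  rewrite [LHS]mcoeff_mono (mcoeff_mono 1 i s j m) (mcoeff_mono 1 i s j (m - U_(k))%MM) lejm !mul1r (raddfMn (delta k)).
  pose P := (\prod_(l < n | l != k) 'C(i l, m l - j l))%N.
  have -> : (\prod_(l < n) 'C((i + U_(k))%MM l, m l - j l) =
             'C((i k).+1, m k - j k) * P)%N.
    rewrite (bigD1 k) //= mnmDE EU eqxx addn1; congr (_ * _)%N.
    apply: eq_bigr => l; rewrite mnmDE EU eq_sym => /negbTE ->.
    by rewrite addn0.
  have -> : (\prod_(l < n) 'C(i l, m l - j l) = 'C(i k, m k - j k) * P)%N.
    by rewrite (bigD1 k).
  set A := dpow (fun l => (i + _)%MM l - _)%N _.
  set C := dpow (fun l => i l - (m l - j l))%N _.
  have dC : delta k C *+ ('C(i k, m k - j k) * P)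
            = A *+ ('C(i k, m k - j k) * P).
    have [le|lt] := leqP (m k - j k) (i k); last by rewrite bin_small.
    congr (_ *+ _); rewrite /A /C -dpowS; apply: (@eq_delta_pow (nonassoc_of R) n delta) => l.
    rewrite mnmDE EU; case: eqP => [<-|]; last by rewrite !addn0.
    by rewrite !addn1 subSn.
  rewrite dC; case: ifP => [gt0|]; last first.
    by move/negbT; rewrite -leqNgt leqn0 => /eqP ->; rewrite !bin0 add0r.
  have -> : (j <= m - U_(k))%MM.
    apply/mnm_lepP => l; rewrite mnmBE EU; case: eqP => [<-|_].
      by move: gt0; rewrite subn_gt0 subn1; case: (m k).
    by rewrite subn0.
  have -> : (\prod_(l < n) 'C(i l, (m - U_(k))%MM l - j l) =
             'C(i k, (m k - j k).-1) * P)%N.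
    rewrite (bigD1 k) //= mnmBE EU eqxx subn1 -predn_sub; congr (_ * _)%N.
    apply: eq_bigr => l; rewrite mnmBE EU eq_sym => /negbTE ->.
    by rewrite subn0.
  set B := dpow _ _; have -> : B = A.
    apply: (@eq_delta_pow (nonassoc_of R) n delta) => l; rewrite mnmBE mnmDE EU; case: eqP => [<-|_].
      by rewrite subn1 addn1 -predn_sub -[in RHS](prednK gt0) subSS.
    by rewrite subn0 addn0.
  by rewrite -mulrnDr -mulnDl addnC -{1}(prednK gt0) binS prednK.
have out m : ~~ (j <= m)%MM ->
    forall u, (mono 1 u s j)@_m = 0.
  by move=> nle u; rewrite mcoeff_mono (negbTE nle).
apply/malgP => m; have [mk|mk] := posnP (m k).
  have -> := @mcoeff_lmulX_out R (multinom n) (delta k) (shift k)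
    (mono 1 i s j) m.
    case: (boolP (j <= m)%MM) => [lejm|nle]; last by rewrite !(out m nle) raddf0.
    by rewrite main // mk add0r.
  by move=> u; apply/eqP => /mnmP/(_ k); rewrite mnmDE EU eqxx addn1 mk.
have em : (m - U_(k) + U_(k))%MM = m.
  apply/mnmP => l; rewrite mnmDE mnmBE EU; case: eqP => [<-|_].
    by rewrite subnK.
  by rewrite subn0 addn0.
have := @mcoeff_lmulX R (multinom n) (delta k) (shift k)
  (mono 1 i s j) (m - U_(k))%MM inj.
rewrite em => ->; case: (boolP (j <= m)%MM) => [lejm|nle].
  rewrite main //; case: ifP => // /negbT; rewrite -leqNgt leqn0 => /eqP e0.
  rewrite (out (m - U_(k))%MM) //; apply/negP => /mnm_lepP/(_ k); rewrite mnmBE EU eqxx subn1.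
  move: e0 => /eqP; rewrite subn_eq0 => mj jm.
  by have := leq_trans mj jm; rewrite -ltnS prednK // ltnn.
rewrite !(out m nle) raddf0 addr0 (out (m - U_(k))%MM) //; apply: contra nle => /mnm_lepP le.
by apply/mnm_lepP => l; apply: leq_trans (le l) _; rewrite mnmBE leq_subr.
Qed.

Lemma diff_mulC r f g : lmulC r f ** g = lmulC r (f ** g).
Proof.
move: f; apply: malg_ext => [u v|u v|i a].
- exact: etrans (congr1 (diff_mul^~ g) (lmulCD r u v)) (diff_mulDl _ _ _).
- exact: etrans (congr1 (lmulC r) (diff_mulDl u v g)) (lmulCD _ _ _).
move: g; apply: malg_ext => [u v|u v|j b].
- exact: diff_mulDr.
- exact: etrans (congr1 (lmulC r) (diff_mulDr _ u v)) (lmulCD _ _ _).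
rewrite lmulCU [LHS]diff_mulUU [X in _ = lmulC r X]diff_mulUU.
by rewrite [LHS]mono_lmulC [X in _ = lmulC r X]mono_lmulC lmulCA.
Qed.

Lemma diff_mulX k f g : lmulX k f ** g = lmulX k (f ** g).
Proof.
move: f; apply: malg_ext => [u v|u v|i a].
- exact: etrans (congr1 (diff_mul^~ g) (lmulXD _ _ u v)) (diff_mulDl _ _ _).
- exact: etrans (congr1 (lmulX k) (diff_mulDl u v g)) (lmulXD _ _ _ _).
move: g; apply: malg_ext => [u v|u v|j b].
- exact: diff_mulDr.
- exact: etrans (congr1 (lmulX k) (diff_mulDr _ u v)) (lmulXD _ _ _ _).
rewrite lmulXU diff_mulDl [X in X + _]diff_mulUU [X in _ + X]diff_mulUU.
rewrite [X in _ = lmulX k X]diff_mulUU.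
rewrite [X in X + _]mono_lmulC [X in _ + X]mono_lmulC.
rewrite [X in _ = lmulX k X]mono_lmulC [X in lmulC _ X + _]mono_lmulX.
by rewrite (lmulX_lmulC _ _ _ (deriv_leibniz delta k)).
Qed.

Lemma monomE r i : (<< r *g i >> : M) = lmulC r << 1 *g i >>.
Proof. by rewrite lmulCU mulr1. Qed.

Lemma monomS k i :
  (<< 1 *g (i + U_(k))%MM >> : M) = lmulX k << 1 *g i >>.
Proof. by rewrite lmulXU deriv1 monalgU0 addr0. Qed.

Lemma monom_ind (P : multinom n -> Prop) :
  P 0%MM -> (forall k i, P i -> P (i + U_(k))%MM) -> forall i, P i.
Proof.
move=> P0 PS i; move: {2}(mpoly.mdeg i) (erefl (mpoly.mdeg i)) => d.
elim: d i => [|d IH] i di.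
  by move/eqP: di; rewrite mpoly.mdeg_eq0 => /eqP ->.
have [k ik] : exists k, (0 < i k)%N.
  apply/existsP; apply: contra_eqT di; rewrite negb_exists => /forallP i0.
  rewrite mpoly.mdegE big1 // => k _; apply/eqP; rewrite -leqn0 leqNgt; exact: i0.
have e : i = (i - U_(k) + U_(k))%MM.
  apply/mnmP => l; rewrite mnmDE mnmBE mnm1E; case: eqP => [<-|_].
    by rewrite subnK.
  by rewrite subn0 addn0.
rewrite e; apply/PS/IH; move: di; rewrite e mpoly.mdegD mpoly.mdeg1 addn1 => -[<-].
by rewrite -e.
Qed.

Lemma diff_mul1r : left_id diff_one diff_mul.
Proof.
apply: malg_ext => [u v|//|j b]; first exact: diff_mulDr.
rewrite [LHS]diff_mulUU; apply/malgP => m.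
rewrite [LHS]mcoeff_mono [RHS]mcoeffU mul1r.
case: (eqVneq j m) => [<-|ne].
  have -> : (j <= j)%MM by apply/mnm_lepP.
  rewrite big1 => [|k _]; last by rewrite subnn mnm0E.
  rewrite mulr1n /dpow /delta_pow; elim/big_rec: _ => // k g _ /= ->.
  by rewrite mnm0E sub0n.
rewrite mulr0n; case: ifP => // /mnm_lepP lejm.
suff [k lt] : exists k, (0 < m k - j k)%N.
  by rewrite (bigD1 k) //= mnm0E bin_small.
apply/existsP; apply: contraNT ne; rewrite negb_exists => /forallP H.
apply/eqP/mnmP => k; apply/eqP.
by rewrite eqn_leq lejm /= -subn_eq0 -leqn0 leqNgt; exact: H.
Qed.

Lemma diff_mulr1 : right_id diff_one diff_mul.
Proof.
apply: malg_ext => [u v|//|i a]; first exact: diff_mulDl.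
rewrite monomE diff_mulC; apply: (congr1 (lmulC _)); elim/monom_ind: i => [|k i IH].
  exact: diff_mul1r.
by rewrite monomS diff_mulX IH.
Qed.

Lemma diff_mulA : associative diff_mul.
Proof.
move=> f g h; move: f; apply: malg_ext => [u v|u v|i a].
- exact: diff_mulDl.
- exact: etrans (congr1 (diff_mul^~ h) (diff_mulDl u v g)) (diff_mulDl _ _ _).
rewrite monomE [LHS]diff_mulC [X in _ = X ** h]diff_mulC [RHS]diff_mulC.
apply: (congr1 (lmulC _)); elim/monom_ind: i => [|k i IH].
  by rewrite [LHS]diff_mul1r [X in _ = X ** h]diff_mul1r.
by rewrite monomS [LHS]diff_mulX [X in _ = X ** h]diff_mulX [RHS]diff_mulX IH.
Qed.

(* R[x_1, ..., x_n; delta_1, ..., delta_n]; the element << r *g i >> is the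
   monomial r x^i.  The ring structure below is not the monoid-algebra one that
   {malg _[_]} carries by default, whence the separate type. *)
Definition diff_poly : Type := {malg R[multinom n]}.

HB.instance Definition _ := GRing.Zmodule.on diff_poly.
HB.instance Definition _ := GRing.Zmodule_isPzRing.Build diff_poly
  diff_mulA diff_mul1r diff_mulr1 diff_mulDl diff_mulDr.

Definition homog_ext (alpha : R -> R) (f : M) : M :=
  \sum_(i <- msupp f) << alpha f@_i *g i >>.

Section HomogeneousExtension.
Variable alpha : {rmorphism R -> R}.
Hypothesis alpha_delta : forall k a, alpha (delta k a) = delta k (alpha a).

Fact ext_termD (i : multinom n) :
  {morph (fun s => << alpha s *g i >> : M) : x y / x + y}.
Proof. by move=> x y; rewrite (rmorphD alpha) monalgUD. Qed.

Lemma homog_extU r i : homog_ext alpha << r *g i >> = << alpha r *g i >>.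
Proof. exact: (msumU ext_termD). Qed.

Fact homog_extD : {morph homog_ext alpha : f g / f + g}.
Proof. move=> f g; exact: (msumD ext_termD). Qed.

Fact homog_ext0 : homog_ext alpha 0 = 0.
Proof. by rewrite /homog_ext msupp0 big_seq_fset0. Qed.

Fact homog_ext1 : homog_ext alpha (1 : diff_poly) = 1 :> diff_poly.
Proof. by rewrite [LHS]homog_extU rmorph1. Qed.

Lemma homog_ext_lmulC r f :
  homog_ext alpha (lmulC r f) = lmulC (alpha r) (homog_ext alpha f).
Proof.
move: f; apply: malg_ext => [u v|u v|i a].
- exact: etrans (congr1 _ (lmulCD r u v)) (homog_extD _ _).
- exact: etrans (congr1 _ (homog_extD u v)) (lmulCD _ _ _).
by rewrite lmulCU [LHS]homog_extU [X in _ = lmulC _ X]homog_extU lmulCU rmorphM.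
Qed.

Lemma homog_ext_lmulX k f :
  homog_ext alpha (lmulX k f) = lmulX k (homog_ext alpha f).
Proof.
move: f; apply: malg_ext => [u v|u v|i a].
- exact: etrans (congr1 _ (lmulXD _ _ u v)) (homog_extD _ _).
- exact: etrans (congr1 _ (homog_extD u v)) (lmulXD _ _ _ _).
rewrite lmulXU homog_extD [X in X + _]homog_extU [X in _ + X]homog_extU.
by rewrite [X in _ = lmulX k X]homog_extU [RHS]lmulXU alpha_delta.
Qed.

Lemma homog_ext_mul f g :
  homog_ext alpha (f ** g) = homog_ext alpha f ** homog_ext alpha g.
Proof.
move: f; apply: malg_ext => [u v|u v|i a].
- exact: etrans (congr1 _ (diff_mulDl u v g)) (homog_extD _ _).
- exact: etrans (congr1 (diff_mul^~ _) (homog_extD u v)) (diff_mulDl _ _ _).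
rewrite homog_extU (monomE a) (monomE (alpha a)).
rewrite [X in homog_ext _ X]diff_mulC [RHS]diff_mulC homog_ext_lmulC.
apply: (congr1 (lmulC _)); elim/monom_ind: i => [|k i IH].
  by rewrite [X in homog_ext _ X]diff_mul1r [RHS]diff_mul1r.
rewrite monomS [X in homog_ext _ X]diff_mulX [RHS]diff_mulX.
by rewrite homog_ext_lmulX IH.
Qed.

Fact homog_ext_nmod :
  nmod_morphism (homog_ext alpha : diff_poly -> diff_poly).
Proof. by split; [exact: homog_ext0 | exact: homog_extD]. Qed.

Fact homog_ext_monoid :
  monoid_morphism (homog_ext alpha : diff_poly -> diff_poly).
Proof. by split; [exact: homog_ext1 | exact: homog_ext_mul]. Qed.

(* The extension of alpha by r x^i |-> alpha(r) x^i, as a ring endomorphism. *)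
Definition homog_endo : {rmorphism diff_poly -> diff_poly} :=
  HB.pack (homog_ext alpha : diff_poly -> diff_poly)
    (GRing.isNmodMorphism.Build diff_poly diff_poly _ homog_ext_nmod)
    (GRing.isMonoidMorphism.Build diff_poly diff_poly _ homog_ext_monoid).

End HomogeneousExtension.
End DiffPoly.

(* Main.v *)
Require Import Defs.
From mathcomp Require Import all_boot all_algebra.
From mathcomp.multinomials Require Import mpoly monalg.
From mathcomp Require Import boolp.

Set Implicit Arguments.
Unset Strict Implicit.
Unset Printing Implicit Defensive.

Import GRing.Theory.
Local Open Scope ring_scope.

(** Both sides live on the same additive group, so only the products need comparing. The map
    [homog_ext alpha] is additive and acts on coefficients alone, so it can be pushed through the
    sums defining the product down to single terms. There it turns the coefficient product [r * d]
    into [alpha (r * d)], which is the product of [yau_twist alpha] ([homog_ext_monom_mul]). *)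

(** Function extensionality identifies the products, and proof irrelevance the distributivity laws.
    Sharing [V] avoids any transport between carriers. *)
Lemma eq_NonassocRing (V : zmodType) (m1 m2 : V -> V -> V)
    (l1 : left_distributive m1 +%R) (r1 : right_distributive m1 +%R)
    (l2 : left_distributive m2 +%R) (r2 : right_distributive m2 +%R) :
  m1 =2 m2 -> NonassocRing l1 r1 = NonassocRing l2 r2.
Proof.
move=> eq_m; have {}eq_m : m1 = m2 by do 2!apply: funext => ?; exact: eq_m.
subst m2.
by rewrite (Prop_irrelevance l1 l2) (Prop_irrelevance r1 r2).
Qed.

Section HomogeneousExtensionMul.
Variables (R : pzRingType) (n : nat) (alpha : {rmorphism R -> R}).
Variable delta : commDerivations R n.

Lemma homog_ext_sum (I : Type) (s : seq I) (P : pred I)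
    (F : I -> {malg R[multinom n]}) :
  homog_ext alpha (\sum_(i <- s | P i) F i)
  = \sum_(i <- s | P i) homog_ext alpha (F i).
Proof. exact: (big_morph _ (homog_extD alpha) (homog_ext0 n alpha)). Qed.

Lemma homog_ext_monom_mul (r : R) (i : multinom n) (s : R) (j : multinom n) :
  homog_ext alpha (monom_mul (S := nonassoc_of R) delta r i s j)
  = monom_mul (S := yau_twist alpha) delta r i s j.
Proof.
rewrite /monom_mul [LHS]homog_ext_sum; apply: eq_bigr => l _.
(* The twisted product is [alpha (r * _)] by definition, so it remains to move [alpha] past the
   binomial multiple. *)
by rewrite [LHS]homog_extU; congr mkmalgU; exact: rmorphMn.
Qed.

Lemma homog_ext_diff_mul (f g : {malg R[multinom n]}) :
  homog_ext alpha (diff_mul delta f g)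
  = poly_mul (S := yau_twist alpha) delta f g.
Proof.
rewrite /diff_mul /poly_mul [LHS]homog_ext_sum; apply: eq_bigr => i _.
by rewrite [LHS]homog_ext_sum; apply: eq_bigr => j _; exact: homog_ext_monom_mul.
Qed.

End HomogeneousExtensionMul.

Theorem proposition5 (R : pzRingType) (n : nat) (alpha : {rmorphism R -> R})
    (delta : commDerivations R n)
    (alpha_delta : forall (k : 'I_n) (a : R),
       alpha (delta k a) = delta k (alpha a)) :
  yau_twist (homog_endo alpha_delta)
    = nonassoc_poly (S := yau_twist alpha) delta :> nonassocRing.
Proof.
(* The additive group of [diff_poly] is convertible to this one. *)
apply: (@eq_NonassocRing {malg R[multinom n]}) => f g.
exact: homog_ext_diff_mul.
Qed.
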